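(* Let $M$ be a separable metrizable space. Then the following are equivalent: (1) $\mathcal{K}(M)\ge_T\mathcal{K}(\mathbb{Q})$; (2) $\mathcal{K}(M)$ is not hereditarily Baire; and (3) for some $n$, $\mathcal{K}^n(M)$ is not hereditarily Baire.
   Context: For directed sets $P,Q$, write $P\ge_T Q$ if there is a map $\phi:P\to Q$ carrying every cofinal subset of $P$ to a cofinal subset of $Q$. For a space $X$, $\mathcal{K}(X)$ is the set of compact subsets of $X$, ordered by inclusion, and also topologized by the Vietoris topology, with basic open sets $\langle U_1,\ldots,U_n\rangle=\{K\in\mathcal{K}(X):K\subseteq\bigcup_iU_i\text{ and }K\cap U_i\neq\emptyset\text{ for each }i\}$ for open $U_1,\ldots,U_n\subseteq X$. Set $\mathcal{K}^0(X)=X$ and $\mathcal{K}^{n+1}(X)=\mathcal{K}(\mathcal{K}^n(X))$ for $n\in\omega$. A space is Baire if every countable intersection of dense open sets is dense; it is hereditarily Baire if every closed subspace is Baire. $\mathbb{Q}$ is the space of rationals. *)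

(* Defs.v *)
From HB Require Import structures.
From mathcomp Require Import all_boot all_order all_algebra.
From mathcomp Require Import all_classical all_reals all_analysis.

Set Implicit Arguments.
Unset Strict Implicit.
Unset Printing Implicit Defensive.

Import Order.TTheory GRing.Theory Num.Theory.

Local Open Scope classical_set_scope.
Local Open Scope ring_scope.

Record directedSet := DirectedSet {
  dcarrier :> Type;
  dle : dcarrier -> dcarrier -> Prop;
  dle_refl : forall x, dle x x;
  dle_trans : forall x y z, dle x y -> dle y z -> dle x z;
  dle_directed : forall x y, exists z, dle x z /\ dle y z
}.

Definition cofinal (P : directedSet) (A : set P) : Prop :=
  forall p : P, exists2 a, A a & dle p a.

Definition tukey_ge (P Q : directedSet) : Prop :=
  exists phi : P -> Q, forall A : set P, cofinal A -> cofinal (phi @` A).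

Definition metrizable (R : realType) (X : topologicalType) : Prop :=
  exists d : X -> X -> R,
    [/\ forall x y, d x y = 0 <-> x = y,
        forall x y, d x y = d y x,
        forall x y z, d x z <= d x y + d y z
      & forall (x : X) (A : set X),
          nbhs x A <-> exists2 e : R, 0 < e & [set y | d x y < e] `<=` A].

Definition separable (X : topologicalType) : Prop :=
  exists2 D : set X, countable D & dense D.

Definition baire (X : topologicalType) : Prop :=
  forall F : nat -> set X,
    (forall i, open (F i) /\ dense (F i)) -> dense (\bigcap_i F i).

(* [set_type C] carries the subspace topology on the subset [C]; the library's
   [subspace C] would not do, as it keeps the points outside [C] and makes them
   isolated. *)
Definition hereditarily_baire (X : topologicalType) : Prop :=
  forall C : set X, closed C -> baire (set_type C).

(* The empty set is a compact subset; it is isolated, as the list of open sets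
   defining a basic open set may be empty. *)
Record hyperspace (X : topologicalType) := Hyperspace {
  hset :> set X;
  hset_compact : compact hset
}.

HB.instance Definition _ (X : topologicalType) := gen_eqMixin (hyperspace X).
HB.instance Definition _ (X : topologicalType) :=
  gen_choiceMixin (hyperspace X).

Section vietoris.
Variable X : topologicalType.

Definition vietoris_basic (s : seq (set X)) : set (hyperspace X) :=
  [set K : hyperspace X | K `<=` \bigcup_(U in [set` s]) U /\
            forall U, U \in s -> K `&` U !=set0].

Definition vietoris_index : set (seq (set X)) :=
  [set s | forall U, U \in s -> open U].

Lemma vietoris_cover :
  \bigcup_(s in vietoris_index) vietoris_basic s = setT.
Proof.
rewrite -subTset => K _.
have [K0|K0] := pselect ((K : set X) !=set0).
  exists [:: setT]; first by move=> U; rewrite inE => /eqP ->; exact: openT.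
  split; first by move=> x _; exists setT => //=; rewrite inE.
  by move=> U; rewrite inE => /eqP ->; rewrite setIT.
exists [::]; first by move=> U.
by split=> // x Kx; case: K0; exists x.
Qed.

Lemma vietoris_join (s t : seq (set X)) (K : hyperspace X) :
  vietoris_index s -> vietoris_index t ->
  vietoris_basic s K -> vietoris_basic t K ->
  exists r, [/\ vietoris_index r, vietoris_basic r K
    & vietoris_basic r `<=` vietoris_basic s `&` vietoris_basic t].
Proof.
move=> os ot [Ks sK] [Kt tK].
pose bs := \bigcup_(U in [set` s]) U; pose bt := \bigcup_(U in [set` t]) U.
exists ([seq U `&` bt | U <- s] ++ [seq U `&` bs | U <- t]); split.
- move=> U; rewrite mem_cat => /orP[] /mapP[V Vi ->]; apply: openI.
  + exact: os.
  + by apply: bigcup_open => W; exact: ot.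
  + exact: ot.
  + by apply: bigcup_open => W; exact: os.
- split=> [x Kx|U].
    have [U /= Us Ux] := Ks _ Kx; exists (U `&` bt); last by split=> //; exact: Kt.
    by rewrite /= mem_cat (map_f (fun U => U `&` bt)).
  rewrite mem_cat => /orP[] /mapP[V Vi ->].
    by have [x [Kx Vx]] := sK _ Vi; exists x; split=> //; split=> //; exact: Kt.
  by have [x [Kx Vx]] := tK _ Vi; exists x; split=> //; split=> //; exact: Ks.
- move=> L [Lr rL]; split; split.
  + move=> x /Lr[U /=]; rewrite mem_cat => /orP[] /mapP[V Vi ->] [Vx bx] //.
    by exists V.
  + move=> U Us; have [|x [Lx [Ux _]]] := rL (U `&` bt).
      by rewrite mem_cat (map_f (fun U => U `&` bt)).
    by exists x.
  + move=> x /Lr[U /=]; rewrite mem_cat => /orP[] /mapP[V Vi ->] [Vx bx] //.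
    by exists V.
  + move=> U Ut; have [|x [Lx [Ux _]]] := rL (U `&` bs).
      by rewrite mem_cat (map_f (fun U => U `&` bs)) ?orbT.
    by exists x.
Qed.

HB.instance Definition _ := isPointed.Build (seq (set X)) [::].

HB.instance Definition _ := isBaseTopological.Build (hyperspace X)
  vietoris_cover vietoris_join.

Definition hyperspace_le (K L : hyperspace X) : Prop := K `<=` L.

Lemma hyperspace_le_refl (K : hyperspace X) : hyperspace_le K K.
Proof. by []. Qed.

Lemma hyperspace_le_trans (K L N : hyperspace X) :
  hyperspace_le K L -> hyperspace_le L N -> hyperspace_le K N.
Proof. exact: subset_trans. Qed.

Lemma hyperspace_le_directed (K L : hyperspace X) :
  exists N, hyperspace_le K N /\ hyperspace_le L N.
Proof.
have KL := @compactU X K L (@hset_compact X K) (@hset_compact X L).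
by exists (Hyperspace KL); split=> x; [left|right].
Qed.

Definition compact_sets : directedSet :=
  DirectedSet hyperspace_le_refl hyperspace_le_trans hyperspace_le_directed.

End vietoris.

Fixpoint iter_hyperspace (n : nat) (X : topologicalType) : topologicalType :=
  if n is m.+1 then hyperspace (iter_hyperspace m X) else X.

(* Main.v *)
(* Call a scheme a family of points x_s (s a finite sequence of naturals) with
   closed sets B_s containing x_s, decreasing along the tree, such that the B_sn
   converge to x_s as n grows and the intersection of the B_s along any infinite
   branch is empty. A regular second countable space fails to be hereditarily
   Baire iff it has a scheme (a weak form of Hurewicz's theorem on closed copies
   of the rationals).

   A scheme in X gives K(X) >=_T K(Q): relatively compact subsets of Q
   correspond to well-founded trees, and {x_s : s in T} is compact for
   well-founded T, while no compact set contains x_s along a whole branch. As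
   K(X) >=_T K(K(X)) by union, this yields (3) => (1).

   For (1) => (2), let phi : K(M) -> K(Q) witness the Tukey relation, let
   theta(K) be the intersection of the phi(L) over L containing K, so that theta
   is monotone, and let (q_s) be a scheme in Q. If one can choose K_0, K_1, ...
   approaching each other as fast as prescribed, with q_{s_i} in theta(K_i) for
   a branch (s_i), then these choices form a scheme in K(M): a limit K of the
   K_i would make the union of K and all the K_i compact, with an image under
   theta containing a whole branch. Otherwise an ordinal rank measures the
   failure, and the Lindelof property of K(M) turns the rank into one compact
   set of rationals contained in no theta(K). *)
Require Import Defs.
From mathcomp Require Import all_boot all_order all_algebra.
From mathcomp Require Import all_classical all_reals all_analysis.
From mathcomp Require Import lra.

Set Implicit Arguments.
Unset Strict Implicit.
Unset Printing Implicit Defensive.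

Import Order.TTheory GRing.Theory Num.Theory.

Local Open Scope classical_set_scope.

(** * Compactness, regularity and countable bases *)

(** Otherwise the differences of [K] with the open sets satisfying [P] would generate a proper
    filter on [K], since [P] is stable under unions; the open set given at a cluster point
    contradicts this. *)
Lemma compact_open_ind (X : topologicalType) (K : set X) (P : set X -> Prop) :
  compact K -> P set0 -> (forall A B, P A -> P B -> P (A `|` B)) ->
  (forall x, K x -> exists A, [/\ open A, A x & P A]) ->
  exists A, [/\ open A, K `<=` A & P A].
Proof.
move=> cK P0 PU PK; apply: contrapT => nA.
pose D := [set A : set X | open A /\ P A].
pose F := filter_from D (fun A => K `\` A).
have FF : ProperFilter F.
  apply: filter_from_proper.
    apply: filter_from_filter; first by exists set0; split => //; exact: open0.
    move=> A B [oA PA] [oB PB]; exists (A `|` B).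
      by split; [exact: openU|exact: PU].
    by rewrite setDUr.
  move=> A [oA PA]; apply: contrapT => KA; apply: nA; exists A; split => // x Kx.
  by apply: contrapT => Ax; apply: KA; exists x.
have FK : F K by exists set0; [split => //; exact: open0|rewrite setD0].
have [x [Kx clx]] := cK F FF FK.
have [A [oA Ax PA]] := PK x Kx.
have [|y [[_ nAy] Ay]] := clx (K `\` A) A _ (open_nbhs_nbhs (conj oA Ax)).
  by exists A.
exact: nAy.
Qed.

Lemma second_countable_seq (X : topologicalType) : @second_countable X ->
  exists b : nat -> set X, (forall i, open (b i)) /\
    forall x U, nbhs x U -> exists i, b i x /\ b i `<=` U.
Proof.
move=> [B cB [oB bB]]; have [f finj] := countable_injP _ cB.
exists (fun n => \bigcup_(U in [set U | B U /\ f U = n]) U); split.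
  by move=> i; apply: bigcup_open => U [/oB].
move=> x U xU; have [V [BV Vx] VU] := bB x U xU.
exists (f V); split; first by exists V.
by move=> y [W [BW fW] Wy]; apply: VU; rewrite (finj V W) ?inE.
Qed.

Definition regular_second_countable (X : topologicalType) : Prop :=
  regular_space X /\ @second_countable X.

Lemma regular_nbhs (X : topologicalType) (x : X) (U : set X) :
  regular_space X -> nbhs x U -> exists V, [/\ open V, V x & closure V `<=` U].
Proof.
move=> rX /rX[V]; rewrite nbhsE => -[W [oW Wx] WV] VU.
by exists W; split => //; apply: subset_trans VU; exact: closureS.
Qed.

(** A stand-in for shrinking closed balls: [V x n] is the intersection of the closures of the basic
    sets around [x] with index at most [n], and regularity makes these fit into every
    neighbourhood. *)
Lemma regular_second_countable_nbhs (X : topologicalType) :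
  regular_second_countable X ->
  exists V : X -> nat -> set X, [/\ forall x n, closed (V x n),
    forall x n, nbhs x (V x n) &
    forall x U, nbhs x U -> exists N, forall n, (N <= n)%N -> V x n `<=` U].
Proof.
move=> [rX /second_countable_seq[b [ob bb]]].
exists (fun x n => \bigcap_(i in [set i | (i <= n)%N /\ b i x]) closure (b i)).
split.
- by move=> x n; apply: closed_bigI => i _; exact: closed_closure.
- move=> x n; elim: n => [|n IHn].
    have [b0|nb0] := pselect (b 0%N x).
      apply: filterS (open_nbhs_nbhs (conj (ob 0%N) b0)) => y by0 i [].
      by rewrite leqn0 => /eqP -> _; exact: subset_closure.
    by apply: nearW => y i []; rewrite leqn0 => /eqP ->.
  have [b0|nb0] := pselect (b n.+1 x).
    apply: filterS2 IHn (open_nbhs_nbhs (conj (ob n.+1) b0)) => y yn by0 i [].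
    rewrite leq_eqVlt => /orP[/eqP -> _|ltin bix]; first exact: subset_closure.
    exact: yn.
  apply: filterS IHn => y yn i [].
  by rewrite leq_eqVlt => /orP[/eqP -> //|ltin bix]; exact: yn.
- move=> x U /(regular_nbhs rX)[W [oW Wx WU]].
  have [i [bix biW]] := bb x W (open_nbhs_nbhs (conj oW Wx)).
  exists i => n lein y /(_ i (conj lein bix)) byi; apply: WU.
  exact: closureS byi.
Qed.

(** * The Vietoris topology: regularity and countable base *)

Section hyperspace_topology.
Variable X : topologicalType.
Implicit Types (K L : hyperspace X) (U : set X) (s : seq (set X)).

Lemma nbhs_hyperspaceP K (A : set (hyperspace X)) :
  nbhs K A <-> exists s, [/\ vietoris_index s, vietoris_basic s K
    & vietoris_basic s `<=` A].
Proof.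
split.
  rewrite nbhsE => -[B [[D sD <-] [s Ds Ks]] BA].
  by exists s; split => //; [exact: sD|move=> L Ls; apply: BA; exists s].
move=> [s [os Ks sA]]; rewrite nbhsE; exists (vietoris_basic s) => //.
split => //; exists [set s]; first by move=> _ ->.
by rewrite bigcup_set1.
Qed.

Lemma open_hyperspace_sub U : open U ->
  open [set K : hyperspace X | K `<=` U].
Proof.
move=> oU; rewrite openE => K KU; rewrite /interior.
have [K0|K0] := pselect ((K : set X) !=set0); apply/nbhs_hyperspaceP.
  exists [:: U]; split; first by move=> V; rewrite inE => /eqP ->.
    split; first by move=> x /KU Ux; exists U => //=; rewrite inE.
    move=> V; rewrite inE => /eqP ->; case: K0 => x Kx.
    by exists x; split => //; exact: KU.
  by move=> L [LU _] x /LU[V /=]; rewrite inE => /eqP ->.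
exists [::]; split => //; first by split=> // x Kx; case: K0; exists x.
by move=> L [L0 _] x /L0[].
Qed.

Lemma open_hyperspace_meet U : open U ->
  open [set K : hyperspace X | K `&` U !=set0].
Proof.
move=> oU; rewrite openE => K KU; apply/nbhs_hyperspaceP.
exists [:: U; setT]; split.
- by move=> V; rewrite !inE => /orP[]/eqP -> //; exact: openT.
- split; first by move=> x _; exists setT => //=; rewrite !inE eqxx orbT.
  move=> V; rewrite !inE => /orP[]/eqP -> //.
  by case: KU => x [Kx _]; exists x.
- by move=> L [_ /(_ U)]; apply; rewrite inE eqxx.
Qed.

Lemma closed_hyperspace_sub U : closed U ->
  closed [set K : hyperspace X | K `<=` U].
Proof.
move=> cU; rewrite (_ : [set K | _] =
    ~` [set K : hyperspace X | K `&` ~` U !=set0]).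
  by apply: open_closedC; apply: open_hyperspace_meet; exact: closed_openC.
apply/seteqP; split=> K /=; first by move=> KU [x [/KU]].
by move=> KU x Kx; apply: contrapT => nUx; apply: KU; exists x.
Qed.

Lemma closed_hyperspace_meet U : closed U ->
  closed [set K : hyperspace X | K `&` U !=set0].
Proof.
move=> cU; rewrite (_ : [set K | _] =
    ~` [set K : hyperspace X | K `<=` ~` U]).
  by apply: open_closedC; apply: open_hyperspace_sub; exact: closed_openC.
apply/seteqP; split=> K /=; first by move=> [x [Kx Ux]] /(_ x Kx).
by move=> KU; apply: contrapT => K0; apply: KU => x Kx Ux; apply: K0; exists x.
Qed.

Lemma vietoris_basicE s :
  vietoris_basic s = [set K | K `<=` \bigcup_(U in [set` s]) U] `&`
    [set K | forall U, U \in s -> K `&` U !=set0].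
Proof. by []. Qed.

Lemma regular_compact_nbhs K U : regular_space X -> open U -> K `<=` U ->
  exists V, [/\ open V, K `<=` V & closure V `<=` U].
Proof.
move=> rX oU KU; apply: (compact_open_ind (P := fun A => closure A `<=` U)).
- exact: hset_compact.
- by rewrite closure0.
- by move=> A B AU BU; rewrite closureU => x [/AU|/BU].
- move=> x /KU Ux; have [V [oV Vx VU]] :=
    regular_nbhs rX (open_nbhs_nbhs (conj oU Ux)).
  by exists V.
Qed.

(** The covering condition is shrunk around the compact set [K], each meeting condition at a point
    of [K]. The closures of the shrunk sets still do the job, because lying in a closed set and
    meeting a closed set are both closed conditions. *)
Lemma regular_hyperspace : regular_space X -> regular_space (hyperspace X).
Proof.
move=> rX K A /nbhs_hyperspaceP[s [os [Ks sK] sA]].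
suff [B nB BA] : exists2 B, nbhs K B & closure B `<=` vietoris_basic s.
  by exists B => //; exact: subset_trans sA.
rewrite vietoris_basicE.
have [V [oV KV VU]] : exists V, [/\ open V, K `<=` V &
    closure V `<=` \bigcup_(U in [set` s]) U].
  by apply: regular_compact_nbhs => //; apply: bigcup_open => U; exact: os.
have [B nB Bs] : exists2 B, nbhs K B & closure B `<=`
    [set K | forall U, U \in s -> K `&` U !=set0].
  elim: s os {Ks} sK {sA VU} => [|U s IHs] os sK.
    by exists setT; [exact: filterT|].
  have [W Us|W Us|B nB Bs] := IHs; first by apply: os; rewrite inE Us orbT.
    by apply: sK; rewrite inE Us orbT.
  have [x [Kx Ux]] : K `&` U !=set0 by apply: sK; rewrite inE eqxx.
  have oU : open U by apply: os; rewrite inE eqxx.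
  have [W [oW Wx WU]] := regular_nbhs rX (open_nbhs_nbhs (conj oU Ux)).
  exists (B `&` [set L : hyperspace X | L `&` W !=set0]).
    apply: filterI => //; apply: open_nbhs_nbhs; split.
      exact: open_hyperspace_meet.
    by exists x.
  move=> L /closureI[/Bs Ls LW] W'; rewrite inE => /orP[/eqP ->|/Ls//].
  have [y [Ly Wy]] : L `&` closure W !=set0.
    apply: (closed_hyperspace_meet (@closed_closure _ W)).
    apply: closureS LW => N [y [Ny Wy]]; exists y; split => //.
    exact: subset_closure.
  by exists y; split => //; exact: WU.
exists ([set L : hyperspace X | L `<=` V] `&` B).
  apply: filterI => //; apply: open_nbhs_nbhs; split => //.
  exact: open_hyperspace_sub.
move=> L /closureI[LV /Bs LB]; split => //=; apply: subset_trans VU.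
apply: (closed_hyperspace_sub (@closed_closure _ V)).
apply: closureS LV => N /= NV; apply: subset_trans NV _; exact: subset_closure.
Qed.

Lemma second_countable_hyperspace :
  @second_countable X -> @second_countable (hyperspace X).
Proof.
move=> /second_countable_seq[b [ob bb]].
exists (range (fun t : seq nat => vietoris_basic (map b t))).
  exact: (sub_countable (card_image_le _ _) (countableP _)).
have ot (t : seq nat) : vietoris_index (map b t).
  by move=> U /mapP[i _ ->].
split.
  move=> _ [t _ <-]; rewrite openE => K Kt; apply/nbhs_hyperspaceP.
  by exists (map b t); split => //; exact: ot.
move=> K A /nbhs_hyperspaceP[s [os [Ks sK] sA]].
have nbK x U : hset K x -> open U -> U x ->
    exists i, [/\ b i x, b i `<=` U & hset K `&` b i !=set0].
  move=> Kx oU Ux; have [i [bi biU]] := bb x U (open_nbhs_nbhs (conj oU Ux)).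
  by exists i; split => //; exists x.
(* The list [t] will cover [K] by basic sets that meet [K] and refine [s]; the list [u] adds a basic
   set inside each member of [s]. *)
pose good (t : seq nat) := forall i, i \in t ->
  hset K `&` b i !=set0 /\ exists2 U, U \in s & b i `<=` U.
have [V [oV KV [t [gt Vt]]]] : exists V, [/\ open V, hset K `<=` V &
    exists t, good t /\ V `<=` \bigcup_(U in [set` map b t]) U].
  apply: compact_open_ind.
  - exact: hset_compact.
  - by exists [::]; split => [i|x].
  - move=> B C [t [gt Bt]] [u [gu Cu]]; exists (t ++ u); split.
      by move=> i; rewrite mem_cat => /orP[/gt|/gu].
    move=> x [/Bt|/Cu] [U /= Ui Ux]; exists U => //=;
      by rewrite map_cat mem_cat Ui ?orbT.
  - move=> x Kx; have [U Us Ux] := Ks x Kx.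
    have [i [bi biU Ki]] := nbK x U Kx (os _ Us) Ux.
    exists (b i); split => //; exists [:: i]; split.
      by move=> j; rewrite inE => /eqP ->; split => //; exists U.
    by move=> y biy; exists (b i) => //=; rewrite inE.
have [u [gu us]] : exists u, good u /\
    forall U, U \in s -> exists2 i, i \in u & b i `<=` U.
  have gs U : U \in s -> exists i, b i `<=` U /\ hset K `&` b i !=set0.
    move=> Us; have [x [Kx Ux]] := sK U Us.
    by have [i [bi biU Ki]] := nbK x U Kx (os _ Us) Ux; exists i.
  (* The induction runs over a sublist of [s], while the refinement condition keeps referring to the
     whole of [s]. *)
  rewrite {}/good in gt *; move: gs; have : {subset s <= s} by [].
  elim: {1 3 5}s => [|U r IHr] rs gs; first by exists [::].
  have [|W Wr|u [gu ur]] := IHr.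
  - by move=> W Wr; apply: rs; rewrite inE Wr orbT.
  - by apply: gs; rewrite inE Wr orbT.
  have [i [biU Ki]] : exists i, b i `<=` U /\ hset K `&` b i !=set0.
    by apply: gs; rewrite inE eqxx.
  exists (i :: u); split.
    move=> j; rewrite inE => /orP[/eqP ->|/gu//]; split => //.
    by exists U => //; apply: rs; rewrite inE eqxx.
  move=> W; rewrite inE => /orP[/eqP ->|/ur[j ju bj]].
    by exists i => //; rewrite inE eqxx.
  by exists j => //; rewrite inE ju orbT.
exists (vietoris_basic (map b (t ++ u))).
  split; first by exists (t ++ u).
  split.
    move=> x /KV/Vt[W /= Wt Wx]; exists W => //=.
    by rewrite map_cat mem_cat Wt.
  by move=> _ /mapP[i itu ->]; move: itu; rewrite mem_cat => /orP[/gt|/gu] [].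
move=> L [Ltu tuL]; apply: sA; split.
  move=> x /Ltu[_ /mapP[i itu ->] bix].
  have [W Ws biW] : exists2 U, U \in s & b i `<=` U.
    by move: itu; rewrite mem_cat => /orP[/gt|/gu] [].
  by exists W => //; exact: biW.
move=> W /us[i iu biW]; have [|y [Ly biy]] := tuL (b i).
  by apply: map_f; rewrite mem_cat iu orbT.
by exists y; split => //; exact: biW.
Qed.

Lemma regular_second_countable_hyperspace :
  regular_second_countable X -> regular_second_countable (hyperspace X).
Proof.
by move=> [rX cX]; split;
  [exact: regular_hyperspace|exact: second_countable_hyperspace].
Qed.

End hyperspace_topology.

(** * Branches and schemes *)

(** The start [f 0] is arbitrary, so that a tail of a branch is again a branch. *)
Definition is_branch (f : nat -> seq nat) : Prop :=
  forall n, exists m, f n.+1 = m :: f n.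

Lemma branch_choice (P : seq nat -> Prop) (t : seq nat) :
  P t -> (forall s, P s -> exists n, P (n :: s)) ->
  exists2 f, is_branch f & forall n, P (f n).
Proof.
move=> Pt PS.
have [g gP] : {g : seq nat -> nat & forall s, P s -> P (g s :: s)}.
  apply: (@choice _ _ (fun s n => P s -> P (n :: s))) => s.
  have [/PS[n Pn]|nPs] := pselect (P s); last by exists 0%N.
  by exists n.
exists (fun n => iter n (fun s => g s :: s) t).
  by move=> n; exists (g (iter n (fun s => g s :: s) t)).
by elim=> [//|n IHn] /=; exact: gP.
Qed.

Lemma is_branch_size f n : is_branch f -> size (f n) = (size (f 0%N) + n)%N.
Proof.
move=> fb; elim: n => [|n IHn]; first by rewrite addn0.
by have [m ->] := fb n; rewrite /= IHn addnS.
Qed.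

Lemma suffix_cases (s t : seq nat) : suffix s t ->
  t = s \/ exists n, suffix (n :: s) t.
Proof.
move=> /suffixP[r ->]; case/lastP: r => [|r n]; first by left.
by right; exists n; rewrite cat_rcons suffix_suffix.
Qed.

Lemma compact_nested (X : topologicalType) (K : set X) (C : nat -> set X) :
  compact K -> (forall n, C n.+1 `<=` C n) -> (forall n, K `&` C n !=set0) ->
  exists2 p, K p & forall n, closure (C n) p.
Proof.
move=> cK CS KC; pose F := filter_from setT (fun n => K `&` C n).
have Cle m n : (m <= n)%N -> C n `<=` C m.
  move=> /subnK <-; elim: (n - m)%N => [//|k IHk].
  by rewrite addSn; exact: subset_trans (CS _) IHk.
have FF : ProperFilter F.
  apply: filter_from_proper; last by move=> n _; exact: KC.
  apply: filter_from_filter; first by exists 0%N.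
  move=> m n _ _; exists (maxn m n) => // x [Kx Cx].
  by split; split => //; apply: Cle Cx; rewrite ?leq_maxl ?leq_maxr.
have FK : F K by exists 0%N => // x [].
have [p [Kp clp]] := cK F FF FK; exists p => // n U Up.
have [|y [[_ Cy] Uy]] := clp (K `&` C n) U _ Up; first by exists n.
by exists y.
Qed.

(** No separation axiom beyond regularity is assumed, so points are handled up to topological
    indistinguishability, which membership in [closure [set y]] expresses. *)
Lemma regular_closure1_sym (X : topologicalType) (y z : X) : regular_space X ->
  closure [set y] z -> closure [set z] y.
Proof.
move=> rX yz; apply: contrapT => nzy.
have [V [oV Vy Vz]] := regular_nbhs rX
  (open_nbhs_nbhs (conj (closed_openC (@closed_closure _ [set z])) nzy)).
have : closure V z by apply: closureS yz => _ ->.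
by move=> /Vz; apply; exact: subset_closure.
Qed.

Lemma regular_cvg_closure1 (X : topologicalType) (F : set_system X) (y z : X) :
  regular_space X -> ProperFilter F -> F --> y -> F --> z ->
  closure [set y] z.
Proof.
move=> rX FF Fy Fz; apply: contrapT => nyz.
have [V [oV Vz Vy]] := regular_nbhs rX
  (open_nbhs_nbhs (conj (closed_openC (@closed_closure _ [set y])) nyz)).
have FnV : F (~` closure V).
  apply: Fy; apply: open_nbhs_nbhs; split.
    exact: closed_openC (@closed_closure _ V).
  by move=> /Vy; apply; exact: subset_closure.
have FV := Fz V (open_nbhs_nbhs (conj oV Vz)).
have [p [pV npV]] := filter_ex (filterI FV FnV).
by apply: npV; exact: subset_closure.
Qed.

(* Modelled on the rationals, with the irrationals as the branches. Neither
   injectivity of [x] nor disjointness of the [B s] is required. Lists grow at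
   the head: the children of [s] are the [n :: s]. *)
Record scheme (X : topologicalType) (x : seq nat -> X)
    (B : seq nat -> set X) : Prop := Scheme {
  scheme_closed : forall s, closed (B s);
  scheme_mem : forall s, B s (x s);
  scheme_sub : forall s n, B (n :: s) `<=` B s;
  scheme_cvg : forall s U, nbhs (x s) U ->
    exists N, forall n, (N <= n)%N -> B (n :: s) `<=` U;
  scheme_branch : forall f, is_branch f -> forall z, exists n, ~ B (f n) z
}.

Section scheme_theory.
Variables (X : topologicalType) (x : seq nat -> X) (B : seq nat -> set X).
Hypothesis xB : scheme x B.

Lemma scheme_suffix s t : suffix s t -> B t `<=` B s.
Proof.
move=> /suffixP[r ->]; elim: r => [//|n r IHr] /=.
by apply: subset_trans IHr; exact: (scheme_sub xB).
Qed.

Lemma scheme_compact_branch K f : compact K -> is_branch f ->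
  (forall n, K `&` B (f n) !=set0) -> False.
Proof.
move=> cK fb KB; have [n|p _ Bp] := compact_nested (C := B \o f) cK _ KB.
  by have [m /= ->] := fb n; exact: (scheme_sub xB).
have [n] := scheme_branch xB fb p; apply.
exact/(scheme_closed xB)/Bp.
Qed.

(** An ultrafilter living on the subtree above [s] but on none of the subtrees of its children
    converges to [x s]: all but finitely many children have [B (n :: s)] inside a given
    neighbourhood, and the remaining ones are excluded one by one. If this never happens, a child
    can always be chosen, which gives a branch. *)
Lemma scheme_ultra (T : set (seq nat)) (F : set_system X) :
  UltraFilter F -> F (x @` T) ->
  (exists s, F --> x s /\ exists2 t, T t & suffix s t) \/
  exists2 f, is_branch f &
    forall n, F (x @` (T `&` [set t | suffix (f n) t])).
Proof.
move=> FU FT; apply: contrapT => /not_orP[nF]; apply.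
pose P s := F (x @` (T `&` [set t | suffix s t])).
apply: (@branch_choice P [::]).
  by apply: filterS FT => _ [t Tt <-]; exists t => //; split => //=;
    exact: suffix0s.
move=> s Ps; apply: contrapT => nPs; apply: nF; exists s; split; last first.
  by have [_ [t [Tt st] _]] := filter_ex Ps; exists t.
move=> U xU; have [//|FnU] := in_ultra_setVsetC U FU; exfalso.
have [N NU] := scheme_cvg xB xU.
have FN : F [set z | forall n, (n < N)%N ->
    ~ (x @` (T `&` [set t | suffix (n :: s) t])) z].
  elim: N {NU} => [|N IHN]; first exact: filterE.
  have [FN|FN] := in_ultra_setVsetC
    (x @` (T `&` [set t | suffix (N :: s) t])) FU.
    by exfalso; apply: nPs; exists N.
  apply: filterS2 IHN FN => z zN zn n.
  rewrite ltnS leq_eqVlt => /orP[/eqP ->//|].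
  exact: zN.
have [z [[[t [Tt st] <-] Uz] zN]] := filter_ex (filterI (filterI Ps FnU) FN).
apply: Uz; case: (suffix_cases st) => [->|[n nt]]; first exact: nbhs_singleton.
have [nN|Nn] := ltnP n N; first by case: (zN n nN); exists t.
by apply: (NU n Nn); apply: scheme_suffix nt _ _; exact: (scheme_mem xB).
Qed.

Lemma scheme_compact (T : set (seq nat)) :
  (forall s t, suffix s t -> T t -> T s) ->
  (forall f, is_branch f -> exists n, ~ T (f n)) -> compact (x @` T).
Proof.
move=> Tdown Tb; rewrite compact_ultra => F FU FT.
have [[s [Fs [t Tt st]]]|[f fb Ff]] := scheme_ultra FU FT.
  by exists (x s); split => //; exists s => //; exact: Tdown Tt.
have [n []] := Tb f fb; have [_ [t [Tt ft] _]] := filter_ex (Ff n).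
exact: Tdown Tt.
Qed.

(** The dichotomy is applied to an ultrafilter converging to [y]; if it followed a branch, [y] would
    lie in every [B (f n)]. *)
Lemma scheme_closure_range : regular_space X ->
  closure (range x) `<=` \bigcup_s closure [set x s].
Proof.
move=> rX y; rewrite closureEcvg => -[G GF [Gy Gx]].
have [F [FU GF']] := ultraFilterLemma GF.
have Fy : F --> y by move=> U /Gy/GF'.
have Fx : F (range x) by apply/GF'/Gx.
have [[s [Fs _]]|[f fb Ff]] := scheme_ultra FU Fx.
  by exists s => //; exact: regular_cvg_closure1 Fs Fy.
have [n] := scheme_branch xB fb y; case.
apply: (scheme_closed xB) => U /Fy FU'.
have [_ [[t [_ ft] <-] Ut]] := filter_ex (filterI (Ff n) FU').
by exists (x t); split => //; apply: scheme_suffix ft _ _; exact: (scheme_mem xB).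
Qed.

(* The closure of the range of [x] is the union of the nowhere dense sets
   [closure [set x s]]. *)
Lemma scheme_not_hereditarily_baire :
  regular_space X -> ~ hereditarily_baire X.
Proof.
move=> rX; pose C := closure (range x).
have Cx s : C (x s) by apply: subset_closure; exists s.
pose pt s : set_type C := exist _ (x s) (mem_set (Cx s)).
(* Indices that code no sequence receive the whole space, which is open and dense. *)
pose F (n : nat) : set (set_type C) := if unpickle n is Some s then
  [set z | ~ closure [set x s] (set_val z)] else setT.
move=> /(_ C (@closed_closure _ _)) bC.
suff oF i : open (F i) /\ dense (F i).
  have [||z [_ Fz]] := bC F oF setT; [by exists (pt [::])|exact: openT|].
  have [s _ zs] := scheme_closure_range rX (set_mem (valP z)).
  have := Fz (pickle s) I; rewrite /F pickleK; exact.
rewrite /F; case: unpickle => [s|]; last first.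
  by split; [exact: openT|move=> O [z Oz] _; exists z].
split.
  exists (~` closure [set x s]) => //.
  exact: closed_openC (@closed_closure _ _).
move=> O [z Oz] [W oW WO]; move: Oz; rewrite -{}WO /= => Wz.
apply: contrapT => WF.
have [y [[t _ <-] Wt]] :=
  set_mem (valP z) W (open_nbhs_nbhs (conj oW Wz)).
(* If [W] met the range only in points indistinguishable from [x s], a branch staying in [W] would
   have [x s] in all its closed sets. *)
have [u Wu|f fb Wf] := @branch_choice (fun u => W (x u)) t Wt.
  have [N] := scheme_cvg xB (open_nbhs_nbhs (conj oW Wu)).
  by move=> /(_ N (leqnn N)) NW; exists N; apply: NW; exact: (scheme_mem xB).
have [n] := scheme_branch xB fb (x s); apply.
have : closure [set x s] (x (f n)).
  apply: contrapT => nxs; apply: WF; exists (pt (f n)).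
  by split; [exact: Wf|exact: nxs].
move=> /(regular_closure1_sym rX) xfs; apply: (scheme_closed xB).
by apply: closureS xfs => _ ->; exact: (scheme_mem xB).
Qed.

End scheme_theory.

(** * Construction of schemes *)

(** Each node carries a state and a closed neighbourhood of its point inside [D]. The [n]-th child
    is an [r]-successor whose neighbourhood lies in that of its parent and in [V (pt s) n]: this
    makes the children converge, and [D] empties the branches. *)
Lemma scheme_build (X : topologicalType) (C : set X) (S : Type)
    (pt : S -> X) (D : S -> set X) (r : S -> S -> Prop) (s0 : S) :
  regular_second_countable X -> closed C ->
  (forall s, C (pt s)) -> (forall s, nbhs (pt s) (D s)) ->
  (forall s U, nbhs (pt s) U -> exists2 t, U (pt t) & r s t) ->
  (forall f : nat -> S, (forall n, r (f n) (f n.+1)) ->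
    forall z, C z -> exists n, ~ D (f n) z) ->
  exists x B, @scheme X x B.
Proof.
move=> rscX cC Cpt nD rpt rb; have [V [cV nV bV]] :=
  regular_second_countable_nbhs rscX.
pose good (p : S * set X) :=
  [/\ closed p.2, nbhs (pt p.1) p.2 & p.2 `<=` D p.1].
have step (p : {p | good p}) (n : nat) : exists q : {p | good p},
    r (sval p).1 (sval q).1 /\
    (sval q).2 `<=` (sval p).2 `&` V (pt (sval p).1) n.
  case: p => -[s A] [/= cA nA AD].
  have nAV : nbhs (pt s) (A `&` V (pt s) n)° .
    by apply: nbhs_interior; exact: filterI.
  have [t tAV st] := rpt s _ nAV.
  have [U [oU Ut UD]] := regular_nbhs (proj1 rscX) (filterI tAV (nD t)).
  have gt : good (t, closure U).
    split => /=; first exact: closed_closure.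
      apply: filterS (open_nbhs_nbhs (conj oU Ut)); exact: subset_closure.
    by move=> y /UD[].
  by exists (exist _ _ gt); split => //= y /UD[].
have [g gP] := choice
  (fun pn : {p | good p} * nat => step pn.1 pn.2).
have [p0] : exists p : {p | good p}, (sval p).1 = s0.
  have [U [oU Us UD]] := regular_nbhs (proj1 rscX) (nD s0).
  suff gs : good (s0, closure U) by exists (exist _ _ gs).
  split => //=; first exact: closed_closure.
  apply: filterS (open_nbhs_nbhs (conj oU Us)); exact: subset_closure.
move=> _; pose st := fix st (s : seq nat) : {p | good p} :=
  if s is n :: u then g (st u, n) else p0.
exists (fun s => pt (sval (st s)).1), (fun s => C `&` (sval (st s)).2).
split.
- by move=> s; apply: closedI => //; case: (svalP (st s)).
- by move=> s; split => //; case: (svalP (st s)) => _ /nbhs_singleton.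
- by move=> s n y [Cy] /= /(proj2 (gP (st s, n)))[].
- move=> s U /bV[N NU]; exists N => n Nn y [Cy] /= /(proj2 (gP (st s, n)))[_].
  exact: NU.
- move=> f fb z; have [Cz|nCz] := pselect (C z); last first.
    by exists 0%N => -[].
  have [n|n nD'] := rb (fun n => (sval (st (f n))).1) _ z Cz.
    by have [m ->] := fb n; exact: (proj1 (gP (_, _))).
  by exists n => -[_]; case: (svalP (st (f n))) => _ _ fD /fD.
Qed.

(** A state is a point of [C] in [W] and in the first [n] sets [G i]. Density of [F n] provides
    nearby successors at stage [n.+1], and a common point along a chain would lie in [O] and in
    every [F i]. *)
Lemma not_hereditarily_baire_scheme (X : topologicalType) :
  regular_second_countable X -> ~ hereditarily_baire X ->
  exists x B, @scheme X x B.
Proof.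
move=> rscX /existsNP[C /not_implyP[cC /existsNP[F /not_implyP[FO]]]].
move=> /existsNP[ O /not_implyP[[z0 Oz0] /not_implyP[oO nOF]]].
have /choice[G GF] i : exists U, open U /\ F i = set_val @^-1` U.
  by have [[U oU <-] _] := FO i; exists U.
move: oO => [W oW WO].
pose good (p : nat * X) :=
  [/\ C p.2, W p.2 & forall i, (i < p.1)%N -> G i p.2].
have oG n : open (W `&` [set z | forall i, (i < n)%N -> G i z]).
  elim: n => [|n IHn].
    by rewrite (_ : [set z | _] = setT) ?setIT //; apply/seteqP; split.
  rewrite (_ : [set z | _] = [set z | forall i, (i < n)%N -> G i z] `&` G n).
    by rewrite setIA; apply: openI => //; case: (GF n).
  apply/seteqP; split=> z /=.
    by move=> Gz; split => [i ni|]; apply: Gz => //; exact: ltnW.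
  by move=> [Gz Gn] i; rewrite ltnS leq_eqVlt => /orP[/eqP -> //|/Gz].
have g0 : good (0%N, set_val z0).
  by split => //=; [exact: set_mem (valP z0)|move: Oz0; rewrite -WO].
apply: (@scheme_build X C {p | good p} (fun p => (sval p).2)
  (fun p => W `&` [set z | forall i, (i < (sval p).1)%N -> G i z])
  (fun p q => (sval q).1 = (sval p).1.+1) (exist _ _ g0)) => //.
- by move=> p; case: (svalP p).
- move=> p; apply: open_nbhs_nbhs; split; first exact: oG.
  by case: (svalP p).
- move=> [[n z] [/= Cz Wz Gz]] U; rewrite nbhsE => -[A [oA Az] AU].
  have [||y [[Ay [Wy Gy]] Fy]] := proj2 (FO n) (set_val @^-1`
      (A `&` (W `&` [set z | forall i, (i < n)%N -> G i z]))).
    by exists (exist _ z (mem_set Cz)).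
    by exists (A `&` (W `&` [set z | forall i, (i < n)%N -> G i z])) => //;
      exact: openI.
  have gy : good (n.+1, set_val y).
    split => //=; first exact: set_mem (valP y).
    move=> i; rewrite ltnS leq_eqVlt => /orP[/eqP -> |/Gy//].
    by move: Fy; rewrite (proj2 (GF n)).
  by exists (exist _ _ gy) => //=; exact: AU.
- move=> f fr z Cz; apply: contrapT => nz; apply: nOF.
  have fE n : (sval (f n)).1 = ((sval (f 0%N)).1 + n)%N.
    by elim: n => [|n IHn]; [rewrite addn0|rewrite fr IHn addnS].
  have Dz n : W z /\ forall i, (i < (sval (f n)).1)%N -> G i z.
    by apply: contrapT => nDz; apply: nz; exists n.
  exists (exist _ z (mem_set Cz)); split.
    by rewrite -WO; case: (Dz 0%N).
  move=> i _; rewrite (proj2 (GF i)); apply: (proj2 (Dz i.+1)).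
  by rewrite fE addnS ltnS leq_addl.
Qed.

(** * Tukey reductions between families of compact sets *)

Lemma compact_near_open (X : topologicalType) (K : set X) (I : Type)
    (F : set_system I) (P : I -> X -> Prop) :
  Filter F -> compact K ->
  (forall x, K x -> \forall x' \near x & i \near F, P i x') ->
  exists A, [/\ open A, K `<=` A & \forall i \near F, A `<=` P i].
Proof.
move=> FF cK PK; apply: compact_open_ind => //.
- by apply: filterE => i; exact: sub0set.
- by move=> A B FA FB; apply: filterS2 FA FB => i AP BP x [/AP|/BP].
- move=> x /PK[[U G] /= [xU FG] UG].
  move: xU; rewrite nbhsE => -[W [oW Wx] WU].
  exists W; split => //; apply: filterS FG => i Gi y Wy.
  by apply: (UG (y, i)); split => //; exact: WU.
Qed.

(** If the condition fails at [q], the [p] with [phi p] not above [q] form a cofinal set whose image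
    is not cofinal. *)
Lemma tukey_geP (P Q : directedSet) : tukey_ge P Q <->
  exists phi : P -> Q, forall q, exists p, forall p', dle p p' ->
    dle q (phi p').
Proof.
split=> -[phi phiP]; exists phi.
  move=> q; apply: contrapT => nq.
  have cA : cofinal [set p | ~ dle q (phi p)].
    move=> p; apply: contrapT => np; apply: nq; exists p => p' pp'.
    by apply: contrapT => nqp'; apply: np; exists p'.
  by have [_ [a na <-] qa] := phiP _ cA q.
move=> A cA q; have [p pP] := phiP q; have [a Aa pa] := cA p.
by exists (phi a); [exists a|exact: pP].
Qed.

Lemma tukey_ge_trans (P Q S : directedSet) :
  tukey_ge P Q -> tukey_ge Q S -> tukey_ge P S.
Proof.
move=> [f fP] [g gP]; exists (g \o f) => A cA.
by rewrite -image_comp; apply/gP/fP.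
Qed.

(** An ultrafilter [F] of compact subsets of [K] converges to the set of those points of [K] all of
    whose neighbourhoods are met by [F]-many of them. *)
Lemma compact_hyperspace_sub (X : topologicalType) (K : set X) :
  compact K -> compact [set L : hyperspace X | L `<=` K].
Proof.
move=> cK; rewrite compact_ultra => F FU FK.
pose C := [set x : X | forall U, nbhs x U ->
  F [set L : hyperspace X | L `&` U !=set0]].
have cC : closed C.
  move=> x xC U; rewrite nbhsE => -[W [oW Wx] WU].
  have [y [Cy Wy]] := xC W (open_nbhs_nbhs (conj oW Wx)).
  have := Cy W (open_nbhs_nbhs (conj oW Wy)).
  by apply: filterS => L [z [Lz Wz]]; exists z; split => //; exact: WU.
exists (Hyperspace (compact_closedI cK cC)); split; first by move=> x [].
move=> A /nbhs_hyperspaceP[s [os [Ks sK] sA]]; apply: filterS sA _.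
rewrite vietoris_basicE; apply: filterI; last first.
  elim: s os {Ks} sK => [|U s IHs] os sK; first exact: filterE.
  have [x [[Kx Cx] Ux]] : (K `&` C) `&` U !=set0 by apply: sK; rewrite inE eqxx.
  have oU : open U by apply: os; rewrite inE eqxx.
  have FU' := Cx U (open_nbhs_nbhs (conj oU Ux)).
  apply: filterS2 FU' (IHs _ _).
  - by move=> L LU Ls W; rewrite inE => /orP[/eqP ->|/Ls].
  - by move=> W Ws; apply: os; rewrite inE Ws orbT.
  - by move=> W Ws; apply: sK; rewrite inE Ws orbT.
set U := \bigcup_(_ in _) _ in Ks *.
have oU : open U by apply: bigcup_open => W; exact: os.
have cKU : compact (K `&` ~` U).
  by apply: compact_closedI => //; exact: open_closedC.
have [||x [Kx nUx]|A' [_ KUA FA]] := compact_open_ind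
    (P := fun A => F [set L : hyperspace X | ~ (L `&` A !=set0)]) cKU.
- by apply: filterE => L [y []].
- move=> A1 A2 F1 F2; apply: filterS2 F1 F2 => L n1 n2 [y [Ly [A1y|A2y]]].
    by apply: n1; exists y.
  by apply: n2; exists y.
- have [W nW] : exists W, ~ (nbhs x W ->
      F [set L : hyperspace X | L `&` W !=set0]).
    by apply/existsNP => Cx; apply: nUx; apply: Ks.
  have [xW nFW] := proj1 (not_implyP _ _) nW.
  move: xW; rewrite nbhsE => -[W' [oW' W'x] W'W].
  exists W'; split => //.
  have [FW'|//] := in_ultra_setVsetC
    [set L : hyperspace X | L `&` W' !=set0] FU.
  exfalso; apply: nFW; apply: filterS FW' => L [y [Ly W'y]].
  by exists y; split => //; exact: W'W.
- apply: filterS2 FK FA => L LK LA x Lx; apply: contrapT => nUx.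
  by apply: LA; exists x; split => //; apply: KUA; split => //; exact: LK.
Qed.

(** A property valid eventually on an open set around [L] is valid on all compact sets near [L], so
    near-covering passes from [K] to its union. *)
Lemma compact_hyperspace_bigcup (X : topologicalType)
    (K : set (hyperspace X)) : compact K ->
  compact (\bigcup_(L in K) (L : set X)).
Proof.
move=> /compact_near_coveringP cK; apply/compact_near_coveringP => I F P FF PK.
have : \forall i \near F, K `<=` [set L : hyperspace X | L `<=` P i].
  apply: (cK I F (fun i L => (L : hyperspace X) `<=` P i)) => L KL.
  have [x Lx|A [oA LA FA]] :=
    compact_near_open (P := P) FF (@hset_compact X L).
    by apply: PK; exists L.
  exists ([set L' : hyperspace X | L' `<=` A], [set i | A `<=` P i]).
    split => //=; apply: open_nbhs_nbhs; split => //.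
    exact: open_hyperspace_sub.
  by move=> [L' i] /= [L'A AP]; exact: subset_trans AP.
by apply: filterS => i KP x [L /KP]; exact.
Qed.

Lemma tukey_ge_hyperspace (X : topologicalType) :
  tukey_ge (compact_sets X) (compact_sets (hyperspace X)).
Proof.
apply/tukey_geP.
exists (fun K : hyperspace X =>
  Hyperspace (compact_hyperspace_sub (@hset_compact X K))) => K.
exists (Hyperspace (compact_hyperspace_bigcup (@hset_compact _ K))).
by move=> L KL M KM x Mx; apply: KL; exists M.
Qed.

(* A subset of [Y] is relatively compact unless some ultrafilter containing it
   avoids a neighbourhood of every [r i]; [J s] records the first [size s] of
   these neighbourhoods. *)
Lemma scheme_tukey_ge (X Y : topologicalType) (x : seq nat -> X)
    (B : seq nat -> set X) (r : nat -> Y) :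
  scheme x B -> regular_second_countable Y -> range r = setT ->
  tukey_ge (compact_sets X) (compact_sets Y).
Proof.
move=> xB rscY rT; have [V [cV nV bV]] := regular_second_countable_nbhs rscY.
pose J := fix J (s : seq nat) : set Y :=
  if s is n :: u then J u `&` ~` V (r (size u)) n else setT.
have oJ s : open (J s).
  elim: s => [|n s IHs] /=; first exact: openT.
  by apply: openI => //; exact: closed_openC.
have Jsuffix s t : suffix s t -> J t `<=` J s.
  by move=> /suffixP[u ->]; elim: u => [//|n u IHu] y /= [/IHu].
have JV s i : (i < size s)%N -> exists k, J s `<=` ~` V (r i) k.
  elim: s => [//|n s IHs] /=; rewrite ltnS leq_eqVlt => /orP[/eqP ->|/IHs[k Jk]].
    by exists n => y [].
  by exists k => y [/Jk].
(* An ultrafilter on [A D] without a limit would trace a branch of sets [J s], and [D] would contain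
   [x s] all along it. *)
pose A (D : set X) := [set q | forall s, J s q -> D (x s)].
have cA (D : hyperspace X) : compact (closure (A D)).
  rewrite compact_ultra => F FU FA; apply: contrapT => nF.
  have nFp (p : Y) : ~ (F --> p).
    move=> Fp; apply: nF; exists p; split => //.
    apply: closed_closure => U /Fp FU'.
    exact: filter_ex (filterI FA FU').
  have [|s Fs|f fb Ff] := @branch_choice (fun s => F (J s)) [::].
  - exact: filterT.
  - have /existsNP[U /not_implyP[pU nFU]] := nFp (r (size s)).
    have [N NU] := bV _ _ pU.
    exists N; apply: filterI => //.
    have [FV|//] := in_ultra_setVsetC (V (r (size s)) N) FU.
    by exfalso; apply: nFU; apply: filterS FV; exact: NU.
  apply: (scheme_compact_branch xB (@hset_compact X D) fb) => n.
  have [q [Aq Jq]] := filter_ex (filterI FA (Ff n)).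
  have [q' [Aq' Jq']] := Aq _ (open_nbhs_nbhs (conj (oJ (f n)) Jq)).
  by exists (x (f n)); split; [exact: Aq'|exact: (scheme_mem xB)].
apply/tukey_geP; exists (fun D : hyperspace X => Hyperspace (cA D)) => L.
(* The tree of all [s] with [J s] meeting [L] is well-founded: along a branch [L] would contain a
   limit point [p] of the [J (f n)], but [p] is some [r i], and a neighbourhood of [r i] has been
   removed. *)
have cL : compact (x @` [set s | (L : hyperspace Y) `&` J s !=set0]).
  apply: (scheme_compact xB).
    move=> s t st [q [Lq Jq]]; exists q; split => //; exact: Jsuffix Jq.
  move=> f fb; apply: contrapT => nf.
  have [n q|n|p _ clp] := compact_nested (C := J \o f) (@hset_compact Y L).
  - by have [m /= ->] := fb n => -[].
  - by apply: contrapT => nfn; apply: nf; exists n.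
  have [i _ rip] : range r p by rewrite rT.
  have [|k Jk] := JV (f i.+1) i.
    by rewrite (is_branch_size _ fb) addnS ltnS leq_addl.
  have Vp : nbhs p (V (r i) k) by rewrite -rip.
  by have [q [/Jk nVq Vq]] := clp i.+1 _ Vp.
exists (Hyperspace cL) => D LD q Lq; apply: subset_closure => s Jq.
by apply: LD; exists s => //; exists q.
Qed.

(** * Ranks and compact sets that [theta] does not cover *)

Lemma compact_setU_seq (X : topologicalType) (Z : set X) (C : nat -> set X) :
  compact Z -> (forall n, compact (C n)) ->
  (forall U, open U -> Z `<=` U ->
    exists N, forall n, (N <= n)%N -> C n `<=` U) ->
  compact (Z `|` \bigcup_n C n).
Proof.
move=> cZ cC ZC; apply/compact_near_coveringP => I F P FF PZ.
have [|A [oA ZA FA]] := compact_near_open (P := P) FF cZ.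
  by move=> x Zx; apply: PZ; left.
have [N CA] := ZC A oA ZA.
have /compact_near_coveringP cCN : compact (\bigcup_(n < N) C n).
  by rewrite bigcup_mkord; exact: bigsetU_compact.
have FCN : \forall i \near F, \bigcup_(n < N) C n `<=` P i.
  by apply: (cCN I F P) => x [n _ Cx]; apply: PZ; right; exists n.
apply: filterS2 FA FCN => i AP CP x [/ZA/AP//|[n _ Cx]].
have [nN|Nn] := ltnP n N; first by apply: CP; exists n.
exact/AP/(CA n).
Qed.

(* The complement of [ranked] is the largest set of pairs [(K, s)] in which,
   arbitrarily close to [K], there is always some [(L, m :: s)] with
   [theta L (q (m :: s))]. *)
Inductive ranked (X Y : topologicalType) (theta : X -> set Y)
    (q : seq nat -> Y) : X -> seq nat -> Prop :=
  Ranked K s U of nbhs K U & (forall L m, U L -> theta L (q (m :: s)) ->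
    ranked theta q L (m :: s)) : ranked theta q K s.

Section ranked_theory.
Variables (X Y : topologicalType) (theta : X -> set Y).
Variables (q : seq nat -> Y) (B : seq nat -> set Y).
Hypotheses (cX : @second_countable X) (qB : scheme q B).

(** Confining [C] to [B s] makes the witnesses chosen at the children of a node converge to its
    point, so that their union can be compact. *)
Definition uncovered (A : set X) (s : seq nat) : Prop :=
  exists C, [/\ compact C, C `<=` B s & forall K, A K -> ~ C `<=` theta K].

(** The witness is [q s] with one compact set below each child. Those [K] with [q s] outside
    [theta K] are settled by [q s], the others by a basic set around [K]. *)
Lemma uncovered_glue (A : set X) (s : seq nat) :
  (forall K, A K -> theta K (q s) ->
    exists2 U, nbhs K U & forall m, uncovered U (m :: s)) ->
  uncovered A s.
Proof.
move=> AU; have [b [ob bb]] := second_countable_seq cX.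
pose good n := forall m, uncovered (b n) (m :: s).
(* The index [n] serves both as basic set and as child of [s]; this is possible because [good n]
   holds at all children. *)
have /choice[C CP] n : exists C, [/\ compact C, C `<=` B (n :: s) &
    good n -> forall K, b n K -> ~ C `<=` theta K].
  have [gn|bn] := pselect (good n).
    by have [C [cC CB Cb]] := gn n; exists C.
  by exists set0; split => //; exact: compact0.
exists ([set q s] `|` \bigcup_n C n); split.
- apply: compact_setU_seq; first exact: compact_set1.
    by move=> n; case: (CP n).
  move=> U oU qU; have [|N NU] := scheme_cvg (U := U) (s := s) qB.
    by apply: open_nbhs_nbhs; split => //; exact: qU.
  by exists N => n /NU; apply: subset_trans; case: (CP n).
- move=> y [-> |[n _ Cy]]; first exact: (scheme_mem qB).
  by apply: (scheme_sub qB (n := n)); case: (CP n) => _ + _; exact.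
- move=> K AK CK; have [|U KU Us] := AU K AK; first by apply: CK; left.
  have [n [bK bU]] := bb K U KU.
  have gn : good n.
    move=> m; have [D [cD DB Dt]] := Us m; exists D; split => // L /bU.
    exact: Dt.
  case: (CP n) => _ _ /(_ gn K bK); apply => y Cy; apply: CK; right.
  by exists n.
Qed.

Lemma ranked_uncovered K s : ranked theta q K s ->
  exists2 U, nbhs K U & forall m, uncovered U (m :: s).
Proof.
elim=> {}K {}s U KU _ IH; exists U => // m; apply: uncovered_glue => L UL.
exact: IH.
Qed.

(** If every [K] were ranked at the root, one more gluing would yield a compact set contained in no
    [theta K]. *)
Lemma not_ranked : (forall C, compact C -> exists K, C `<=` theta K) ->
  exists K, ~ ranked theta q K [::].
Proof.
move=> tC; apply: contrapT => nr.
have [K _ _|C [cC _ nC]] := @uncovered_glue setT [::].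
  by apply: ranked_uncovered; apply: contrapT => nK; apply: nr; exists K.
by have [K CK] := tC C cC; exact: nC CK.
Qed.

End ranked_theory.

(** * From a Tukey reduction to a scheme in the hyperspace *)

Section metric.
Variables (R : realType) (M : topologicalType) (d : M -> M -> R).
Hypothesis d0 : forall x y, d x y = 0%R <-> x = y.
Hypothesis dC : forall x y, d x y = d y x.
Hypothesis dD : forall x y z, (d x z <= d x y + d y z)%R.
Hypothesis nbhsd : forall (x : M) (A : set M),
  nbhs x A <-> exists2 e : R, (0 < e)%R & [set y | (d x y < e)%R] `<=` A.

Lemma metric_nbhs x e : (0 < e)%R -> nbhs x [set y | (d x y < e)%R].
Proof. by move=> e0; apply/nbhsd; exists e. Qed.

Lemma metric_regular_second_countable :
  separable M -> regular_second_countable M.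
Proof.
move=> [S cS dS]; split.
  move=> x U /nbhsd[e e0 eU].
  exists [set y | (d x y < e / 2)%R]; first by apply: metric_nbhs; lra.
  move=> y /(_ _ (@metric_nbhs y (e / 2)%R _))[|z [/= xz yz]]; first by lra.
  apply: eU => /=; apply: le_lt_trans (dD x z y) _.
  by rewrite (dC z); lra.
pose b (p : M * nat) := [set y | (d p.1 y < p.2.+1%:R^-1)%R].
exists (b @` (S `*` setT)).
  apply: sub_countable (card_image_le _ _) _.
  by apply: countableX => //; exact: countableP.
have ob p : open (b p).
  rewrite openE => y /= py; apply/nbhsd.
  exists (p.2.+1%:R^-1 - d p.1 y)%R; first by rewrite subr_gt0.
  by move=> z /=; rewrite ltrBrDl; apply: le_lt_trans; exact: dD.
split; first by move=> _ [p _ <-].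
move=> x U /nbhsd[e e0 eU].
have [n _ ne] : exists2 n, True & (n.+1%:R^-1 < e / 2)%R.
  have [N _ /(_ N (leqnn N)) Ne] :=
    near_infty_natSinv_lt (PosNum (divr_gt0 e0 (ltr0Sn _ 1))).
  by exists N.
have [||c [+ Sc]] := dS (b (x, n)).
- by exists x; rewrite /b /= (proj2 (d0 _ _)) ?invr_gt0.
- exact: ob.
rewrite /b /= => xc; exists (b (c, n)).
  by split; [exists (c, n)|rewrite /b /= dC].
move=> y /= cy; apply: eU => /=.
apply: le_lt_trans (dD _ c _) _; rewrite [e]splitr.
by apply: ltrD; [exact: lt_trans xc ne|exact: lt_trans cy ne].
Qed.

Lemma tukey_ge_scheme (Y : topologicalType) (q : seq nat -> Y)
    (B : seq nat -> set Y) :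
  separable M -> scheme q B -> tukey_ge (compact_sets M) (compact_sets Y) ->
  exists x C, @scheme (hyperspace M) x C.
Proof.
move=> sM qB /tukey_geP[phi phiP].
have rscK := regular_second_countable_hyperspace
  (metric_regular_second_countable sM).
pose theta (K : hyperspace M) : set Y :=
  [set y | forall L : hyperspace M, K `<=` L -> hset (phi L) y].
have [C cC|K0 nK0] := @not_ranked _ _ theta q B (proj2 rscK) qB.
  have [K KP] := phiP (Hyperspace cC).
  by exists K => y Cy L KL; exact: KP.
pose S := {p : hyperspace M * seq nat | ~ ranked theta q p.1 p.2}.
(* One-sided Hausdorff closeness: each point of [K] is near [L]. The radius shrinks with the length
   of [s], so the sets along a chain close in on any common [Z]. *)
pose D (p : S) := [set L : hyperspace M | forall x, hset (sval p).1 x ->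
  exists2 y, hset L y & (d x y < (size (sval p).2).+1%:R^-1)%R].
apply: (@scheme_build _ setT S (fun p => (sval p).1) D
  (fun p p' => (exists m, (sval p').2 = m :: (sval p).2) /\
    theta (sval p').1 (q (sval p').2)) (exist _ (K0, [::]) nK0)) => //.
- move=> [[K s] nKs]; rewrite /D /=; set e := (_^-1)%R.
  have e0 : (0 < e)%R by rewrite invr_gt0.
  have := @hset_compact M K; rewrite compact_near_coveringP => cK.
  apply: (cK _ (nbhs K) (fun L x => exists2 y, hset L y & (d x y < e)%R)).
  move=> x Kx; pose W := [set y | (d x y < e / 2)%R]°.
  have xW : W x by apply: metric_nbhs; lra.
  exists (W, [set L : hyperspace M | L `&` W !=set0]).
    split=> /=; apply: open_nbhs_nbhs; split => //.
    - exact: open_interior.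
    - exact/open_hyperspace_meet/open_interior.
    - by exists x.
  move=> [x' L] /= [/interior_subset /= xx' [y [Ly /interior_subset /= xy]]].
  exists y => //; apply: le_lt_trans (dD _ x _) _.
  by rewrite (dC x'); lra.
(* Without a successor in [U], all admissible pairs over [U] would be ranked, hence [(K, s)] too. *)
- move=> [[K s] /= nKs] U KU; apply: contrapT => nU; apply: nKs.
  apply: (Ranked KU) => L m UL Lm; apply: contrapT => nLm; apply: nU.
  by exists (exist _ (L, m :: s) nLm) => //=; split => //; exists m.
- move=> f fr Z _; apply: contrapT => nZ.
  have DZ n : D (f n) Z by apply: contrapT => nDZ; apply: nZ; exists n.
  pose s n := (sval (f n)).2; pose K n : hyperspace M := (sval (f n)).1.
  have sb : is_branch s by move=> n; case: (fr n).
  have cE : compact (Z `|` \bigcup_n (K n : set M)).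
    apply: compact_setU_seq; [exact: hset_compact| |].
      by move=> n; exact: hset_compact.
    (* Compactness of [Z] gives one radius such that all balls of that radius about points of [Z]
       lie in [U]. *)
    move=> U oU ZU; have [|A [_ ZA [N _ NA]]] := compact_near_open
      (F := \oo) (P := fun n x => [set y | (d x y < n.+1%:R^-1)%R] `<=` U)
      _ (@hset_compact M Z).
      move=> x /ZU Ux; have /nbhsd[e e0 eU] := open_nbhs_nbhs (conj oU Ux).
      exists ([set y | (d x y < e / 2)%R], [set n | (n.+1%:R^-1 < e / 2)%R]).
        split=> /=; first by apply: metric_nbhs; lra.
        exact: near_infty_natSinv_lt (PosNum (divr_gt0 e0 (ltr0Sn _ 1))).
      move=> [x' n] /= [xx' ne] y /= x'y; apply: eU => /=.
      apply: le_lt_trans (dD _ x' _) _; rewrite [e]splitr.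
      by apply: ltrD => //; exact: lt_trans x'y ne.
    exists N => n Nn w Kw; have [y Zy wy] := DZ n w Kw.
    apply: (NA N (leqnn N) y (ZA y Zy)) => /=; rewrite dC.
    apply: lt_le_trans wy _; rewrite lef_pV2 ?posrE // ler_nat ltnS.
    by apply: leq_trans Nn _; rewrite -/(s n) (is_branch_size _ sb) leq_addl.
  (* The shift skips the root: membership in [theta] is known for successors only. *)
  apply: (scheme_compact_branch qB (@hset_compact Y (phi (Hyperspace cE)))
    (f := fun n => s n.+1)) => n; first exact: sb.
  exists (q (s n.+1)); split; last exact: (scheme_mem qB).
  have [_ tq] := fr n; apply: tq => x Kx.
  by right; exists n.+1.
Qed.

End metric.

(** * The space of rationals *)

Lemma regular_second_countable_rat : regular_second_countable rat^o.
Proof.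
split; first exact: uniform_regular.
exists [set ball p.1 p.2 | p in [set p : rat^o * rat | (0 < p.2)%R]].
  exact: sub_countable (card_image_le _ _) (countableP _).
split; first by move=> _ [p p0 <-]; exact: ball_open.
move=> x U /nbhs_ballP[e e0 eU]; exists (ball x e) => //.
by split; [exists (x, e)|exact: ballxx].
Qed.

Definition rat_seq (n : nat) : rat^o := odflt 0%R (unpickle n).

Lemma range_rat_seq : range rat_seq = setT.
Proof.
apply/seteqP; split=> // z _; exists (pickle (z : rat)) => //.
by rewrite /rat_seq pickleK.
Qed.

(** The complements of single points are open, dense as no point is isolated, and countably many of
    them have empty intersection. *)
Lemma rat_not_hereditarily_baire : ~ hereditarily_baire rat^o.
Proof.
move=> /(_ setT closedT) bQ.
have [i|||z [_ Fz]] := bQ (fun n => set_val @^-1` (~` [set rat_seq n])) _ setT.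
- split.
    exists (~` [set rat_seq i]) => //; apply: closed_openC.
    exact: (accessible_closed_set1 (hausdorff_accessible (@norm_hausdorff _ rat^o))).
  move=> O [z Oz] [W oW WO]; move: Oz; rewrite -{}WO /= => Wz.
  have /nbhs_ballP[e /= e0 eW] := open_nbhs_nbhs (conj oW Wz).
  have [zi|nzi] := pselect (set_val z = rat_seq i); last by exists z.
  pose y : rat^o := (set_val z + e / 2)%R.
  exists (exist _ y (mem_set I)); split => /=.
    apply: eW; rewrite -ball_normE /= /y opprD addrA subrr sub0r normrN.
    by rewrite gtr0_norm; lra.
  by rewrite /y zi => /eqP; rewrite -subr_eq0 addrAC subrr add0r => /eqP; lra.
- by exists (exist _ (0%R : rat^o) (mem_set I)).
- exact: openT.
have : range rat_seq (set_val z) by rewrite range_rat_seq.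
by move=> [n _ nz]; apply: (Fz n I); rewrite nz.
Qed.

(** * Iterated hyperspaces and the equivalences *)

Lemma regular_second_countable_iter_hyperspace (n : nat)
    (X : topologicalType) : regular_second_countable X ->
  regular_second_countable (iter_hyperspace n X).
Proof.
move=> rscX; elim: n => [//|n IHn].
exact: regular_second_countable_hyperspace.
Qed.

Lemma tukey_ge_iter_hyperspace (n : nat) (X : topologicalType) :
  tukey_ge (compact_sets X) (compact_sets (iter_hyperspace n X)).
Proof.
elim: n => [|n IHn]; first by exists id => A; rewrite image_id.
exact: tukey_ge_trans IHn (@tukey_ge_hyperspace _).
Qed.

(* [rat^o] is the set of rationals with the topology of the metric `|x - y|. *)
Theorem theorem40 (R : realType) (M : topologicalType)
    (M_metrizable : metrizable R M) (M_separable : separable M) :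
  (tukey_ge (compact_sets M) (compact_sets rat^o) <->
     ~ hereditarily_baire (hyperspace M)) /\
  (~ hereditarily_baire (hyperspace M) <->
     exists n : nat, ~ hereditarily_baire (iter_hyperspace n M)).
Proof.
have [d [d0 dC dD nbhsd]] := M_metrizable.
have rscM := metric_regular_second_countable d0 dC dD nbhsd M_separable.
have h12 : tukey_ge (compact_sets M) (compact_sets rat^o) ->
    ~ hereditarily_baire (hyperspace M).
  have [q [B qB]] := not_hereditarily_baire_scheme
    regular_second_countable_rat rat_not_hereditarily_baire.
  move=> /(tukey_ge_scheme d0 dC dD nbhsd M_separable qB)[x [C xC]].
  apply: (scheme_not_hereditarily_baire xC).
  exact: (proj1 (regular_second_countable_hyperspace rscM)).
have h31 n : ~ hereditarily_baire (iter_hyperspace n M) ->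
    tukey_ge (compact_sets M) (compact_sets rat^o).
  move=> /(not_hereditarily_baire_scheme
    (regular_second_countable_iter_hyperspace n rscM))[x [B xB]].
  apply: tukey_ge_trans (tukey_ge_iter_hyperspace n M) _.
  exact: scheme_tukey_ge xB regular_second_countable_rat range_rat_seq.
split; split.
- exact: h12.
(* [iter_hyperspace 1 M] computes to [hyperspace M]. *)
- exact: (h31 1%N).
- by exists 1%N.
- by move=> [n /h31/h12].
Qed.
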